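(* Let $p$ be a prime, $E$ a finite field extension of $\mathbb Q_p$ with absolute value $|\cdot|$ extending the $p$-adic one ($|p|=1/p$), $m$ a non-negative integer, and $s\colon\mathbb N\to E$ a function. Then $$\sup_{(n_0,\ldots,n_m)\in\mathbb N^{(m)}}|\delta^m s(n_0,\ldots,n_m)| = \sup_{n\ge m}|c(n)|\,p^{\tau_{p,m}(n)},$$ as an equality in $[0,\infty]$ (in particular, one side is infinite if and only if the other is).
   Context: $\mathbb N=\{0,1,2,\ldots\}$, $\mathbb N^{(m)}=\{(n_0,\ldots,n_m)\in\mathbb N^{m+1}: n_i\text{ pairwise distinct}\}$, and $\delta^m s(n_0,\ldots,n_m)=\sum_{i=0}^m\big(\prod_{j\ne i}(n_i-n_j)^{-1}\big)s(n_i)$ is the $m$th divided difference. The finite differences are $c(n)=\sum_{k=0}^n\binom{n}{k}(-1)^{n-k}s(k)$. For $n\ge m$, $\tau_{p,m}(n)$ is the largest $p$-adic valuation of a product of $m$ distinct integers in $\{1,\ldots,n\}$: $\tau_{p,m}(n)=\max_{S\subset\{1,\ldots,n\},\,\#S=m} v_p\big(\prod_{k\in S}k\big)$ (so $\tau_{p,0}=0$). *)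

(* Defs.v *)
From HB Require Import structures.
From mathcomp Require Import all_boot all_order all_algebra all_field.
From mathcomp Require Import all_classical all_reals all_analysis.
Set Implicit Arguments.
Unset Strict Implicit.
Unset Printing Implicit Defensive.
Import Order.TTheory GRing.Theory Num.Theory.
Local Open Scope classical_set_scope.
Local Open Scope ring_scope.

Record absolute_value (R : realType) (K : fieldType) (v : K -> R) : Prop :=
  AbsoluteValue {
    absv_ge0 : forall x, 0 <= v x;
    absv_eq0 : forall x, v x = 0 <-> x = 0;
    absvM : forall x y, v (x * y) = v x * v y;
    absv_triangle : forall x y, v (x + y) <= v x + v y
  }.

(* normalized by |p| = 1/p *)
Definition padic_absv_rat (R : realType) (p : nat) (q : rat) : R :=
  if q == 0 then 0
  else p%:R ^+ logn p `|denq q|%N / p%:R ^+ logn p `|numq q|%N.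

(* (K, v) is the field Q_p with its p-adic absolute value, presented as the
   completion of Q: it is determined by these conditions up to a unique
   isometric field isomorphism. *)
Record is_Qp (R : realType) (p : nat) (K : fieldType) (v : K -> R) : Prop :=
  IsQp {
    Qp_absv : absolute_value v;
    Qp_ratr : forall q : rat, v (ratr q) = padic_absv_rat R p q;
    Qp_dense : forall (x : K) (e : R), 0 < e ->
      exists q : rat, v (x - ratr q) < e;
    Qp_complete : forall u : nat -> K,
      (forall e : R, 0 < e -> exists N : nat, forall i j : nat,
         (N <= i)%N -> (N <= j)%N -> v (u i - u j) < e) ->
      exists l : K, forall e : R, 0 < e -> exists N : nat, forall i : nat,
         (N <= i)%N -> v (u i - l) < e
  }.

(* n : 'I_m.+1 -> nat is the tuple (n_0, ..., n_m) *)
Definition divided_diff (K : fieldType) (s : nat -> K) (m : nat)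
    (n : 'I_m.+1 -> nat) : K :=
  \sum_(i < m.+1)
    (\prod_(j < m.+1 | j != i) ((n i)%:R - (n j)%:R)^-1) * s (n i).

Definition finite_diff (K : fieldType) (s : nat -> K) (n : nat) : K :=
  \sum_(0 <= k < n.+1) 'C(n, k)%:R * (-1) ^+ (n - k) * s k.

(* S ranges over the m-element subsets of {1, ..., n}, viewed inside
   'I_n.+1 = {0, ..., n}. *)
Definition tau (p m n : nat) : nat :=
  (\max_(S : {set 'I_n.+1} | (ord0 \notin S) && (#|S| == m))
     logn p (\prod_(k in S) (k : nat)))%N.

(* Main.v *)
(** Put T_a s (y) = (s (y + a + 1) - s a) / (y + 1). If n_i = a is the smallest
    node, then removing it and subtracting a + 1 from the others turns the
    divided difference of order m + 1 of s into one of order m of T_a s, because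
    divided differences kill constants. On the other side, the i-th finite
    difference of T_a s is Delta^(i+1) s (a) / (i + 1), and for fixed i a bound
    on Delta^(i+1) s (a) for all a is equivalent to the same bound on c(k) for
    all k > i (the case m = 0, which only uses the ultrametric inequality).
    As tau_{m+1}(k) = max_{m <= i < k} (v_p(i + 1) + tau_m(i)) (i + 1 being the
    largest element of an optimal set), induction on m shows that both families
    have the same upper bounds. *)
Require Import Defs.
From HB Require Import structures.
From mathcomp Require Import all_boot all_order all_algebra all_field.
From mathcomp Require Import all_classical all_reals all_analysis.
From mathcomp Require Import ring lra.
Set Implicit Arguments.
Unset Strict Implicit.
Unset Printing Implicit Defensive.
Import Order.TTheory GRing.Theory Num.Theory.
Local Open Scope classical_set_scope.
Local Open Scope ring_scope.

(** * Finite differences of a function and of its shifted quotients *)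

Definition forward_diff (K : fieldType) (s : nat -> K) (n : nat) : K :=
  s n.+1 - s n.

(** The operator [T_a], indexed so that [y] stands for the node [y + a + 1], at distance [y + 1]
    from [a]. *)
Definition shifted_quotient (K : fieldType) (a : nat) (s : nat -> K) (y : nat) : K :=
  (s (y + a).+1 - s a) / y.+1%:R.

Lemma finite_diffS (K : fieldType) (s : nat -> K) n :
  finite_diff s n.+1 = finite_diff (forward_diff s) n.
Proof.
rewrite /finite_diff big_nat_recl // bin0 mul1r subn0.
(* By Pascal's rule the parts with [C(n, k)] collect the values [s (k + 1)], while those with
   [C(n, k + 1)] and the isolated term at 0 give minus the sum over [s k]. *)
under eq_bigr => k _ do rewrite binS natrD !mulrDl subSS.
rewrite big_split /= addrA.
transitivity (- (\sum_(0 <= i < n.+1) 'C(n, i)%:R * (-1) ^+ (n - i) * s i)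
   + \sum_(0 <= i < n.+1) 'C(n, i)%:R * (-1) ^+ (n - i) * s i.+1).
  congr (_ + _).
  rewrite [in RHS]big_nat_recl // [in LHS]big_nat_recr //=.
  rewrite bin_small // !mul0r addr0 bin0 mul1r subn0 opprD exprS mulN1r mulNr.
  congr (_ + _); rewrite -sumrN; apply: eq_big_nat => i /andP[_ ilt].
  by rewrite -[(n - i)%N]subnSK // exprS mulN1r mulrN mulNr.
rewrite -sumrN -big_split /=; apply: eq_bigr => i _.
by rewrite /forward_diff mulrBr addrC.
Qed.

Lemma finite_diff_iter (K : fieldType) (s : nat -> K) n :
  finite_diff s n = iter n (@forward_diff K) s 0.
Proof.
elim: n s => [|n IH] s.
  by rewrite /finite_diff big_nat1 bin0 subn0 expr0 !mul1r.
by rewrite finite_diffS IH -iterSr.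
Qed.

Lemma iter_forward_diff_shift (K : fieldType) (s : nat -> K) a n x :
  iter n (@forward_diff K) (fun y => s (y + a)%N) x
  = iter n (@forward_diff K) s (x + a)%N.
Proof. by elim: n x => //= n IH x; rewrite /forward_diff !IH addSn. Qed.

Lemma finite_diff_sub_cst (K : fieldType) (s : nat -> K) c n :
  finite_diff (fun y => s y - c) n.+1 = finite_diff s n.+1.
Proof.
rewrite !finite_diffS; congr finite_diff.
by apply/funext => y; rewrite /forward_diff opprB addrA subrK.
Qed.

(** Subtracting the constant [s a] kills the first term of the difference of order [i + 1], and
    [C(i, k) (i + 1) = (k + 1) C(i + 1, k + 1)] cancels the denominators [k + 1]. *)
Lemma finite_diff_shifted_quotient (K : fieldType)
    (char0 : forall n, n.+1%:R != 0 :> K) (s : nat -> K) a i :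
  finite_diff (shifted_quotient a s) i
  = iter i.+1 (@forward_diff K) s a / i.+1%:R.
Proof.
apply: (canRL (mulfK (char0 i))).
have := iter_forward_diff_shift s a i.+1 0; rewrite add0n => <-.
rewrite -finite_diff_iter -(finite_diff_sub_cst _ (s a)) /finite_diff.
rewrite [RHS]big_nat_recl //= add0n subrr mulr0 add0r mulr_suml.
apply: eq_bigr => k _; rewrite /shifted_quotient subSS addSn.
have e : 'C(i, k)%:R * i.+1%:R = k.+1%:R * 'C(i.+1, k.+1)%:R :> K.
  by rewrite -!natrM -mul_bin_diag mulnC.
have d_ne0 := char0 k.
transitivity (k.+1%:R * 'C(i.+1, k.+1)%:R * ((-1) ^+ (i - k) *
    ((s (k + a).+1 - s a) / k.+1%:R)) : K).
  by rewrite -e; ring.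
by move: (k.+1%:R : K) d_ne0 => q q0; field.
Qed.

(** * Divided differences and the removal of a node *)

Lemma divided_diff_cst (K : fieldType) (m : nat) (x : 'I_m.+2 -> K) :
  injective x ->
  \sum_(i < m.+2) \prod_(j < m.+2 | j != i) (x i - x j)^-1 = 0.
Proof.
move=> x_inj.
(* The Lagrange interpolant of the constant 1 is 1, so its leading coefficient
   vanishes. *)
pose L i : {poly K} := \prod_(j < m.+2 | j != i) ('X - (x j)%:P).
pose d i := \prod_(j < m.+2 | j != i) (x i - x j)^-1.
pose P := \sum_i d i *: L i - 1.
have LE i : L i = \prod_(j <- index_enum 'I_m.+1) ('X - (x (lift i j))%:P).
  rewrite /L big_mkcond /= (bigD1_ord i) //= eqxx mul1r; apply: eq_bigr => j _.
  by rewrite eq_sym neq_lift.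
have sL i : size (L i) = m.+2.
  by rewrite LE size_prod_XsubC -[index_enum _]enumT size_enum_ord.
have cL i : (L i)`_m.+1 = 1.
  by have /monicP := monic_prod_XsubC (index_enum 'I_m.+1) xpredT (x \o lift i);
    rewrite -LE lead_coefE sL.
have sP : (size P <= m.+2)%N.
  rewrite (leq_trans (size_polyD _ _)) // size_polyN size_poly1 geq_max andbT.
  apply: (leq_trans (size_sum _ _ _)); apply/bigmax_leqP => i _.
  by rewrite (leq_trans (size_scale_leq _ _)) // sL.
have rP k : root P (x k).
  rewrite /root /P hornerD hornerN hornerC horner_sum (bigD1 k) //= big1.
    rewrite addr0 hornerZ horner_prod /d -big_split /= big1 ?subrr // => j jk.
    by rewrite hornerXsubC mulVf // subr_eq0 (inj_eq x_inj) eq_sym.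
  move=> i ik; rewrite hornerZ horner_prod (bigD1 k) ?(eq_sym k) //=.
  by rewrite hornerXsubC subrr mul0r mulr0.
have P0 : P = 0.
  apply: (@roots_geq_poly_eq0 _ _ [seq x k | k <- enum 'I_m.+2]).
  - by apply/allP => _ /mapP[k _ ->].
  - by rewrite map_inj_uniq ?enum_uniq.
  - by rewrite size_map size_enum_ord.
have := congr1 (fun q : {poly K} => q`_m.+1) P0.
rewrite coef0 coefB coef1 /= subr0 coef_sum => P0m; rewrite -[RHS]P0m.
by apply: eq_bigr => i _; rewrite coefZ cL mulr1.
Qed.

Lemma natr_inj_char0 (K : fieldType) (char0 : forall n, n.+1%:R != 0 :> K) :
  injective (fun n : nat => n%:R : K).
Proof.
move=> a b /= ab; wlog ltab : a b ab / (a < b)%N => [H|].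
  by case: (ltngtP a b) => // ltab; [|symmetry]; exact: H.
move/eqP: ab; rewrite eq_sym -subr_eq0 -natrB ?(ltnW ltab) //.
by rewrite -(subnSK ltab) (negPf (char0 _)).
Qed.

(** Since constants have divided difference 0, [s] may be replaced by [s - s (n i0)], which removes
    the term at [i0]. In each other term the factor for [i0] is the denominator of the shifted
    quotient, and the remaining factors are invariant under translation of the nodes. *)
Lemma divided_diff_shifted_quotient (K : fieldType)
    (char0 : forall n, n.+1%:R != 0 :> K) (s : nat -> K) m
    (n : 'I_m.+2 -> nat) (y : 'I_m.+1 -> nat) i0 :
  injective n -> (forall j, n (lift i0 j) = (y j + n i0).+1) ->
  divided_diff s n = divided_diff (shifted_quotient (n i0) s) y.
Proof.
move=> n_inj yE.
have := @divided_diff_cst K m (fun i => (n i)%:R) _.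
move/(_ (inj_comp (natr_inj_char0 char0) n_inj)) => H.
rewrite -[LHS](subr0) -(mul0r (s (n i0))) -H mulr_suml /divided_diff -sumrB.
under eq_bigr => i _ do rewrite -mulrBr.
rewrite (bigD1_ord i0) //= subrr mulr0 add0r; apply: eq_bigr => i _.
rewrite (bigD1_ord i0) ?neq_lift //= /shifted_quotient !yE.
have -> : (y i + n i0).+1%:R - (n i0)%:R = (y i).+1%:R :> K.
  by rewrite -addSn natrD addrK.
rewrite -mulrA mulrC [RHS]mulrA; congr (_ * _ / _).
apply: eq_big => j; first by rewrite (inj_eq lift_inj).
move=> _; rewrite yE -!addSn !natrD opprD addrACA subrr addr0.
by rewrite -!natr1 opprD addrACA subrr addr0.
Qed.

(** * Absolute values and the ultrametric inequality *)

Lemma natr_le_expr_le1 (R : realType) (t : R) :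
  0 <= t -> (forall n, t ^+ n <= n.+1%:R) -> t <= 1.
Proof.
move=> t0 tn; rewrite leNgt; apply/negP => t1.
have [e e0 te] : exists2 e, 0 < e & t = 1 + e.
  by exists (t - 1); rewrite ?subr_gt0 // addrC subrK.
(* (1 + n e)^2 <= t^(2n) <= 2n + 1 fails for large n. *)
have bern n : 1 + e *+ n <= t ^+ n.
  elim: n => [|n IH]; first by rewrite mulr0n addr0.
  rewrite exprS; apply: le_trans (ler_wpM2l t0 IH).
  have : 0 <= e * (e *+ n) by rewrite mulr_ge0 ?mulrn_wge0 // ltW.
  by rewrite te mulrSr; move: (e *+ n) => a; nra.
(* This choice gives [n^2 e^2 > 2 n], hence [(1 + n e)^2 > 2 n + 1]. *)
have [n nP] : exists n : nat, 2 / e ^+ 2 < n%:R.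
  by exists (Num.bound (2 / e ^+ 2)); apply: archi_boundP; rewrite divr_ge0 ?exprn_ge0 // ltW.
have := le_trans _ (tn (n * 2)%N); rewrite exprM => /(_ ((1 + e *+ n) ^+ 2)).
rewrite ler_sqr ?nnegrE ?exprn_ge0 ?addr_ge0 ?mulrn_wge0 ?(ltW e0) // => /(_ (bern n)).
move: nP; rewrite ltr_pdivrMr ?exprn_gt0 // => nP.
rewrite -[(n * 2).+1]addn1 natrD natrM -[e *+ n]mulr_natr.
have n0 : 0 < (n%:R : R).
  by rewrite ltr0n lt0n; apply/eqP => n0; move: nP; rewrite n0 mul0r ltrn0.
move: (n%:R) n0 nP => N n0 nP.
have N2 : N * 2 < N * (N * e ^+ 2) by rewrite ltr_pM2l.
have eN : 0 < e * N by rewrite mulr_gt0.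
nra.
Qed.

Lemma absv1 (R : realType) (K : fieldType) (v : K -> R) :
  absolute_value v -> v 1 = 1.
Proof.
move=> av; have v0 : v 1 != 0 by apply/eqP => /(absv_eq0 av)/eqP; rewrite oner_eq0.
by apply: (mulfI v0); rewrite -(absvM av) !mulr1.
Qed.

Lemma absvX (R : realType) (K : fieldType) (v : K -> R) x n :
  absolute_value v -> v (x ^+ n) = v x ^+ n.
Proof.
move=> av; elim: n => [|n IH]; first by rewrite !expr0 (absv1 av).
by rewrite !exprS (absvM av) IH.
Qed.

Lemma absvN (R : realType) (K : fieldType) (v : K -> R) x :
  absolute_value v -> v (- x) = v x.
Proof.
move=> av; rewrite -mulN1r (absvM av).
have : v (-1) ^+ 2 == 1 by rewrite -absvX // sqrrN expr1n (absv1 av).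
rewrite sqrf_eq1 => /orP[|] /eqP E; rewrite E ?mul1r //.
by have := absv_ge0 av (-1); rewrite E lerNr oppr0 ler10.
Qed.

Lemma absvV (R : realType) (K : fieldType) (v : K -> R) x :
  absolute_value v -> v (x^-1) = (v x)^-1.
Proof.
move=> av; have [->|x0] := eqVneq x 0.
  by rewrite invr0 (_ : v 0 = 0) ?invr0 //; apply/(absv_eq0 av).
have vx0 : v x != 0 by apply: contra_neq x0 => /(absv_eq0 av).
by apply: (mulfI vx0); rewrite -(absvM av) !mulfV // (absv1 av).
Qed.

Lemma absv_ultrametric (R : realType) (K : fieldType) (v : K -> R) B x y :
  absolute_value v -> (forall n, v n%:R <= 1) ->
  v x <= B -> v y <= B -> v (x + y) <= B.
Proof.
move=> av vn xB yB; have B0 := le_trans (absv_ge0 av x) xB.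
(* Expand (x + y)^n and let n grow to remove the factor n + 1. *)
have vxy n : v (x + y) ^+ n <= n.+1%:R * B ^+ n.
  rewrite -absvX // exprDn; have vsum (I : Type) (r : seq I) (F : I -> K) :
      v (\sum_(i <- r) F i) <= \sum_(i <- r) v (F i).
    elim/big_ind2: _ => [|a b c d ab cd|//].
      by rewrite le_eqVlt; apply/orP; left; apply/eqP/(absv_eq0 av).
    by rewrite (le_trans (absv_triangle av _ _)) // lerD.
  apply: (le_trans (vsum _ _ _)).
  apply: (@le_trans _ _ (\sum_(i < n.+1) B ^+ n)); last first.
    by rewrite sumr_const card_ord mulr_natl.
  (* Binomial coefficients are natural numbers, so they have absolute value at most 1. *)
  apply: ler_sum => i _; rewrite -mulr_natr !(absvM av) !(absvX _ _ av).
  rewrite -[leRHS]mulr1; apply: ler_pM => //.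
  - by rewrite mulr_ge0 ?exprn_ge0 ?(absv_ge0 av).
  - exact: absv_ge0.
  have -> : B ^+ n = B ^+ (n - i) * B ^+ i by rewrite -exprD subnK // -ltnS.

  by apply: ler_pM; rewrite ?exprn_ge0 ?(absv_ge0 av) ?lerXn2r ?nnegrE ?(absv_ge0 av).
(* The limit argument divides by [B]; for [B = 0] the exponent 1 already suffices. *)
have [B00|Bneq0] := eqVneq B 0.
  by have := vxy 1%N; rewrite !expr1 B00 mulr0.
have Bgt0 : 0 < B by rewrite lt_neqAle eq_sym Bneq0.
rewrite -[leRHS]mul1r -ler_pdivrMr //.
apply: natr_le_expr_le1 => [|n]; first by rewrite divr_ge0 ?(absv_ge0 av).
by rewrite expr_div_n ler_pdivrMr ?exprn_gt0.
Qed.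

(** Differences inherit a bound by the ultrametric inequality. Conversely [s (n + 1)] is the sum of
    [forward_diff s n] and [s n], so an induction on [n], for all [s] at once, recovers the bound on
    values. *)
Lemma absv_iter_forward_diff_le (R : realType) (K : fieldType) (v : K -> R) B :
  absolute_value v -> (forall n, v n%:R <= 1) -> forall s : nat -> K,
  (forall n, v (s n) <= B) <->
  (forall n, v (iter n (@forward_diff K) s 0) <= B).
Proof.
move=> av vn s; split=> [sB n|cB n].
  elim: n s sB => [|n IH] s sB; first exact: sB.
  rewrite iterSr; apply: IH => k; rewrite /forward_diff.
  by apply: absv_ultrametric => //; rewrite absvN.
elim: n s cB => [|n IH] s cB; first exact: (cB 0).
rewrite -[s n.+1](subrK (s n)).
apply: absv_ultrametric => //; last exact: IH.
by apply: (IH (forward_diff s)) => k; rewrite -iterSr; exact: cB.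
Qed.

(** * A recursion for [tau] *)

Lemma logn_prod_seq p (r : seq nat) :
  all (ltn 0) r -> logn p (\prod_(k <- r) k) = \sum_(k <- r) logn p k.
Proof.
elim: r => [|k r IH] /=; first by rewrite !big_nil logn1.
move=> /andP[k0 r0]; rewrite !big_cons lognM ?IH //.
by rewrite big_seq prodn_cond_gt0 // => i /(allP r0).
Qed.

(** Together with [tau_attained], this replaces subsets of ['I_n.+1] by duplicate-free lists, whose
    type does not change when [n] varies. *)
Lemma logn_le_tau p (r : seq nat) n :
  uniq r -> all (fun k => 0 < k <= n)%N r ->
  (\sum_(k <- r) logn p k <= tau p (size r) n)%N.
Proof.
move=> ur rn; pose S := [set i : 'I_n.+1 | val i \in r]%SET.
have S0 : ord0 \notin S by rewrite inE; apply/negP => /(allP rn).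
have SE : perm_eq [seq val i | i <- enum S] r.
  apply: uniq_perm => //; first by rewrite map_inj_uniq ?enum_uniq //; exact: val_inj.
  move=> k; apply/mapP/idP => [[i]|kr]; first by rewrite mem_enum inE => ? ->.
  have /andP[_ kn] := allP rn _ kr.
  by exists (inord k); rewrite ?mem_enum ?inE /= inordK.
have cS : #|S| == size r by rewrite -(perm_size SE) size_map -cardE.
have := @leq_bigmax_cond _ (fun S : {set 'I_n.+1} => (ord0 \notin S) && (#|S| == size r))
  (fun S => logn p (\prod_(k in S) (k : nat))) S.
rewrite S0 cS => /(_ isT); apply: leq_trans.
rewrite -logn_prod_seq; last by apply/allP => k /(allP rn)/andP[].
by rewrite -(perm_big _ SE) big_map big_enum.
Qed.

Lemma tau_attained p m n : (m <= n)%N ->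
  exists r : seq nat, [/\ uniq r, all (fun k => 0 < k <= n)%N r, size r = m
    & tau p m n = (\sum_(k <- r) logn p k)%N].
Proof.
move=> mn.
pose A := [pred S : {set 'I_n.+1} | (ord0 \notin S) && (#|S| == m)].
pose F (S : {set 'I_n.+1}) := logn p (\prod_(k in S) (k : nat)).
(* An [m]-element subset exists because [m <= n], so the maximum is not the default value 0 of an
   empty family. *)
have A0 : (0 < #|A|)%N.
  have : (0 < 'C(#|~: [set ord0 : 'I_n.+1]%SET|, m))%N.
    by rewrite bin_gt0 cardsC1 card_ord.
  rewrite -cards_draws => /card_gt0P[T]; rewrite inE => /andP[sT cT].
  apply/card_gt0P; exists T; rewrite inE cT andbT.
  by apply/negP => /(fintype.subsetP sT); rewrite !inE eqxx.
have [S] := eq_bigmax_cond F A0; rewrite inE => /andP[S0 /eqP cS] tE.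
have rP : all (fun k => 0 < k <= n)%N [seq val i | i <- enum S].
  apply/allP => _ /mapP[i + ->]; rewrite mem_enum => iS.
  apply/andP; split; last by rewrite -ltnS; exact: ltn_ord.
  rewrite lt0n; apply: contra S0 => /eqP i0.
  by rewrite (_ : ord0 = i) //; exact: val_inj.
exists [seq val i | i <- enum S]; split=> //.
- by rewrite map_inj_uniq ?enum_uniq //; exact: val_inj.
- by rewrite size_map -cardE.
rewrite [LHS]tE /F -logn_prod_seq; first by rewrite big_map big_enum.
by apply/allP => k /(allP rP)/andP[].
Qed.

(** Adjoin [i + 1] to an optimal list in [{1, ..., i}]. *)
Lemma leq_tauS p m n i : (m <= i < n)%N ->
  (logn p i.+1 + tau p m i <= tau p m.+1 n)%N.
Proof.
move=> /andP[mi lin]; have [r [ur rP <- ->]] := tau_attained p mi.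
have := @logn_le_tau p (i.+1 :: r) n; rewrite big_cons; apply.
  by rewrite /= ur andbT; apply/negP => /(allP rP); rewrite ltnn.
rewrite /= lin; apply/allP => k /(allP rP)/andP[-> ki].
exact: leq_trans ki (ltnW lin).
Qed.

(** Take [i + 1] to be the largest element of an optimal list; the [m] others are distinct elements
    of [{1, ..., i}], which also forces [m <= i]. *)
Lemma tauS_leq p m n : (m < n)%N ->
  exists2 i, (m <= i < n)%N & (tau p m.+1 n <= logn p i.+1 + tau p m i)%N.
Proof.
move=> mn; have [r [ur rP sr ->]] := tau_attained p mn.
have [i ir imax] : exists2 i, i.+1 \in r & all (fun k => k <= i.+1)%N r.
  have : \max_(k <- r) k \in r.
    case: r sr {ur rP} => // k0 r _; elim: r k0 => [|k r IH] k0.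
      by rewrite big_seq1 inE.
    rewrite big_cons; have := IH k; set M := \max_(_ <- _) _ => MP.
    by case: (leqP k0 M) => _; rewrite inE ?eqxx // MP orbT.
  case E : (\max_(k <- r) k) => [|i] ir; first by have := allP rP _ ir.
  exists i => //; apply/allP => k kr; rewrite -E.
  exact: (@leq_bigmax_seq _ r xpredT id).
have rem_lt : all (fun k => 0 < k <= i)%N (rem i.+1 r).
  apply/allP => k; rewrite mem_rem_uniq // inE => /andP[ki kr].
  have /andP[-> _] := allP rP _ kr.
  by rewrite -ltnS ltn_neqAle ki; exact: (allP imax).
have srem : size (rem i.+1 r) = m by rewrite size_rem // sr.
exists i.
  have /andP[_ ->] := allP rP _ ir; rewrite andbT -srem.
  have := @uniq_leq_size _ (rem i.+1 r) (iota 1 i) (rem_uniq _ ur).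
  by rewrite size_iota; apply => k /(allP rem_lt); rewrite mem_iota add1n ltnS.
rewrite (big_rem _ ir) /= leq_add2l -srem.
by apply: logn_le_tau => //; exact: rem_uniq.
Qed.

Lemma tau0 p n : tau p 0 n = 0%N.
Proof.
by have [r [_ _ /size0nil -> ->]] := tau_attained p (leq0n n); rewrite big_nil.
Qed.

(** * Induction on the order of the divided difference *)

(** Upper bounds [B] stand in for suprema, and [s] is quantified inside the induction so that the
    hypothesis applies to every [shifted_quotient a s] with the same [B]. *)
Lemma divided_diff_le_finite_diff_le (R : realType) (K : fieldType) (v : K -> R)
    (p : nat) (av : absolute_value v) (p_gt0 : (0 < p)%N)
    (vp : forall n, v n.+1%:R = (p%:R ^+ logn p n.+1)^-1) (m : nat) :
  forall (s : nat -> K) (B : R),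
  (forall n : 'I_m.+1 -> nat, injective n -> v (divided_diff s n) <= B) <->
  (forall n, (m <= n)%N -> v (finite_diff s n) * p%:R ^+ tau p m n <= B).
Proof.
have pX1 k : 1 <= p%:R ^+ k :> R by rewrite exprn_ege1 // ler1n.
have pX0 k : 0 < p%:R ^+ k :> R by exact: lt_le_trans ltr01 (pX1 k).
have char0 n : n.+1%:R != 0 :> K.
  by apply/eqP => /(absv_eq0 av)/eqP; rewrite vp invr_eq0 gt_eqF.
have vn n : v n%:R <= 1.
  case: n => [|n]; last by rewrite vp invf_le1.
  by rewrite (_ : v 0%:R = 0) //; apply/(absv_eq0 av).
elim: m => [|m IH] s B.
  have dd0 (n : 'I_1 -> nat) : divided_diff s n = s (n ord0).
    rewrite /divided_diff big_ord_recl big_ord0 addr0 big1 ?mul1r // => j.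
    by rewrite ord1.
  apply: (iff_trans _ (iff_trans (absv_iter_forward_diff_le B av vn s) _)).
    split=> sB n => [|_]; last by rewrite dd0.
    by rewrite -(dd0 (fun=> n)); apply: sB => i j _; rewrite !ord1.
  split=> cB n; first by rewrite tau0 mulr1 finite_diff_iter.
  by have := cB n isT; rewrite tau0 mulr1 finite_diff_iter.
have step1 : (forall n : 'I_m.+2 -> nat, injective n -> v (divided_diff s n) <= B)
   <-> forall a (y : 'I_m.+1 -> nat), injective y ->
     v (divided_diff (shifted_quotient a s) y) <= B.
  split=> [sB a y y_inj|sB n n_inj].
    pose n i := if unlift ord0 i is Some j then (y j + a).+1 else a.
    have n0 : n ord0 = a by rewrite /n unlift_none.
    have nl j : n (lift ord0 j) = (y j + n ord0).+1 by rewrite n0 /n liftK.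
    have n_inj : injective n.
      move=> i j; rewrite /n.
      case: (unliftP ord0 i) => [i' ->|->]; case: (unliftP ord0 j) => [j' ->|->] //.
      - by move=> /eqP; rewrite eqSS eqn_add2r => /eqP/y_inj ->.
      - by move=> /eqP; rewrite -addSn -[X in _ == X]add0n eqn_add2r.
      - by move=> /eqP; rewrite -addSn -[X in X == _]add0n eqn_add2r.
    by rewrite -n0 -(divided_diff_shifted_quotient char0 _ n_inj nl); exact: sB.
  (* The smallest node may sit at any index [i0]; its minimality makes the truncated subtraction in
     [y] exact. *)
  have [i0 _ i0min] := arg_minnP n (isT : xpredT (ord0 : 'I_m.+2)).
  pose y j := (n (lift i0 j) - (n i0).+1)%N.
  have nl j : n (lift i0 j) = (y j + n i0).+1.
    rewrite -addnS subnK // ltn_neqAle i0min // andbT (inj_eq n_inj).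
    exact: neq_lift.
  rewrite (divided_diff_shifted_quotient char0 _ n_inj nl); apply: sB => i j yij.
  by apply: (@lift_inj _ i0); apply: n_inj; rewrite !nl yij.
apply: (iff_trans step1).
(* Dividing by [i + 1] multiplies the absolute value by [p ^ logn p i.+1], which joins the factor
   from [tau p m i]. *)
have step2 a : (forall y : 'I_m.+1 -> nat, injective y ->
     v (divided_diff (shifted_quotient a s) y) <= B) <->
   forall i, (m <= i)%N ->
     v (iter i.+1 (@forward_diff K) s a) <= B / p%:R ^+ (logn p i.+1 + tau p m i).
  apply: (iff_trans (IH _ B)); split => sB i /sB;
    rewrite finite_diff_shifted_quotient // (absvM av) (absvV _ av) vp invrK;
    by rewrite -mulrA -exprD ler_pdivlMr.
(* The case of order 0, applied to the function sending [a] to the difference of order [i + 1] at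
   [a]: its own differences at 0 are the [finite_diff s k] with [k > i]. *)
have step3 i B' : (forall a, v (iter i.+1 (@forward_diff K) s a) <= B') <->
   forall k, (i < k)%N -> v (finite_diff s k) <= B'.
  apply: (iff_trans (absv_iter_forward_diff_le B' av vn _)).
  split=> [sB k ik|sB k].
    by have := sB (k - i.+1)%N; rewrite -iterD subnK // finite_diff_iter.
  by rewrite -iterD -finite_diff_iter sB // addnS ltnS leq_addl.
split=> [sB n mn|cB a].
  (* Only the index [i] that realizes [tau p m.+1 n] is needed here; the converse uses the
     inequality of [leq_tauS] for every [i < k]. *)
  have [i /andP[mi lin] tauP] := tauS_leq p mn.
  have : v (finite_diff s n) <= B / p%:R ^+ (logn p i.+1 + tau p m i).
    by move: n lin {mn tauP}; apply/step3 => a; exact: (step2 a).1 (sB a) i mi.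
  rewrite ler_pdivlMr //; apply: le_trans; apply: ler_wpM2l; first exact: absv_ge0.
  by apply: ler_weXn2l => //; rewrite ler1n.
apply/step2 => i mi; move: a; apply/step3 => k ik.
rewrite ler_pdivlMr //; apply: le_trans (cB k (leq_ltn_trans mi ik)).
apply: ler_wpM2l; first exact: absv_ge0.
by apply: ler_weXn2l; rewrite ?ler1n // leq_tauS // mi.
Qed.

(** * Finite extensions of [Q_p] and the equality of suprema *)

Lemma Qp_extension_absv_nat (R : realType) (p : nat) (Qp : fieldType) (vp : Qp -> R)
    (Qp_is_Qp : is_Qp p vp) (E : fieldExtType Qp) (v : E -> R)
    (v_ext : forall x : Qp, v (x%:A) = vp x) n :
  v n.+1%:R = (p%:R ^+ logn p n.+1)^-1.
Proof.
have -> : n.+1%:R = (n.+1%:R : Qp)%:A :> E by rewrite scaler_nat.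
rewrite v_ext -(ratr_nat Qp) (Qp_ratr Qp_is_Qp) /padic_absv_rat pnatr_eq0 /=.
by rewrite -[n.+1%:R]/(n.+1%:~R) numq_int denq_int /= logn1 expr0 div1r.
Qed.

Theorem theorem3p2 (R : realType) (p : nat) (p_prime : prime p)
    (Qp : fieldType) (vp : Qp -> R) (Qp_is_Qp : is_Qp p vp)
    (E : fieldExtType Qp) (v : E -> R) (v_absv : absolute_value v)
    (v_ext : forall x : Qp, v (x%:A) = vp x)
    (m : nat) (s : nat -> E) :
  ereal_sup [set ((v (divided_diff s n))%:E) |
              n in [set n : 'I_m.+1 -> nat | injective n]]
  = ereal_sup [set ((v (finite_diff s n) * p%:R ^+ tau p m n)%:E) |
                n in [set n : nat | (m <= n)%N]].
Proof.
have vn := Qp_extension_absv_nat Qp_is_Qp v_ext.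
have iffB := divided_diff_le_finite_diff_le v_absv (prime_gt0 p_prime) vn m s.
set A := (X in ereal_sup X = _); set C := (X in _ = ereal_sup X).
have ge0A x : A x -> (0 <= x)%E.
  by move=> [n _ <-]; rewrite lee_fin (absv_ge0 v_absv).
have ge0C x : C x -> (0 <= x)%E.
  by move=> [n _ <-]; rewrite lee_fin mulr_ge0 ?exprn_ge0 ?(absv_ge0 v_absv).
have A0 : A (v (divided_diff s (@nat_of_ord m.+1)))%:E.
  by exists (@nat_of_ord m.+1) => //; exact: ord_inj.
have C0 : C (v (finite_diff s m) * p%:R ^+ tau p m m)%:E by exists m => /=.
(* A nonnegative member excludes the supremum [-oo]. *)
have finite_or_infty (S : set (\bar R)) x : S x -> (0 <= x)%E ->
    ereal_sup S = +oo%E \/ exists B : R, ereal_sup S = B%:E.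
  move=> Sx x0; have := le_trans x0 (ereal_sup_ubound Sx).
  by case: (ereal_sup S) => // [B|] _; [right; exists B|left].
(* For each inequality, a finite supremum of one family is a real bound [B], which [iffB] transfers
   to the other family. *)
apply/eqP; rewrite eq_le; apply/andP; split; apply: ge_ereal_sup => _ [n nP <-].
- case: (finite_or_infty _ _ C0 (ge0C _ C0)) => [->|[B CB]]; first exact: leey.
  rewrite CB lee_fin; move: n nP; apply/iffB => n mn.
  by rewrite -lee_fin -CB; apply: ereal_sup_ubound; exists n.
- case: (finite_or_infty _ _ A0 (ge0A _ A0)) => [->|[B AB]]; first exact: leey.
  rewrite AB lee_fin; move: n nP; apply/iffB => n n_inj.
  by rewrite -lee_fin -AB; apply: ereal_sup_ubound; exists n.
Qed.
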